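(* Let $D$ be a positive integer and let $H$ be a multigraph (loopless, parallel edges allowed) with $\Delta(H)\le D$. Suppose that each edge of $H$ shares at least one endpoint with all but at most $D-2$ of the other edges of $H$. Then $|E(H)|\le \frac52 D$.
   Context: Degrees in a multigraph count edges with multiplicity. *)

(* Defs.v *)
From mathcomp Require Import all_boot.
Set Implicit Arguments. Unset Strict Implicit. Unset Printing Implicit Defensive.

(* A finite loopless multigraph: vertex type V, edge type E (parallel edges
   are distinct elements of E with the same endpoints), each edge e has the
   two endpoints src e and dst e, with src e <> dst e (looplessness is a
   hypothesis of the theorem). *)

Section Multigraph.
Variables (V E : finType) (src dst : E -> V).

Definition incident (e : E) (x : V) : bool := (src e == x) || (dst e == x).

Definition deg (x : V) : nat := #|[set e | incident e x]|.

Definition maxdeg_le (D : nat) : Prop := forall x : V, deg x <= D.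

Definition share_endpoint (e f : E) : bool := incident f (src e) || incident f (dst e).

Definition non_neighbours (e : E) : {set E} :=
  [set f | (f != e) && ~~ share_endpoint e f].
End Multigraph.

(* Main.v *)
Require Import Defs.
From mathcomp Require Import all_boot.
From mathcomp Require Import zify.

(** Suppose m = |E| > 5D/2, let v be a non-isolated vertex of minimum degree
    d, let k be the number of neighbours of v, and let r be the number of
    remaining non-isolated vertices.  Exactly d(u) + d(v) - mu(u,v) edges meet
    {u, v}, so mu(u,v) <= d(u) + d(v) + D - m for every neighbour u of v;
    summing over u bounds d above in terms of k and of the sum S of the degrees
    of the neighbours.  Both S <= k D and the handshake identity (which gives
    d + S + r d <= 2m) bound S from above.  Since 2m > 5D forces
    1 + k + r >= 6 and d > D/2, each of the cases k <= 2, k = 3, 4, 5 and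
    k >= 6 is contradictory. *)

Section Counting.
Variables (V E : finType) (src dst : E -> V).
Hypothesis loopless : forall e : E, src e != dst e.

Local Notation inc := (incident src dst).
Local Notation deg := (deg src dst).

Definition mult (x y : V) : nat := #|[set e | inc e x & inc e y]|.

Definition nbhd (x : V) : {set V} := [set y | (y != x) && (0 < mult x y)].

Lemma sum_incident (e : E) : \sum_y inc e y = 2.
Proof.
rewrite (bigD1 (src e)) //= (bigD1 (dst e)) /=; last by rewrite eq_sym.
rewrite /incident !eqxx orbT big1 // => y /andP[ys yd].
by rewrite eq_sym (negbTE ys) eq_sym (negbTE yd).
Qed.

Lemma degE (x : V) : deg x = \sum_e inc e x.
Proof. by rewrite /Defs.deg cardsE -sum1_card big_mkcond. Qed.

Lemma multE (x y : V) : mult x y = \sum_(e | inc e x) inc e y.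
Proof.
rewrite /mult cardsE -sum1_card [RHS]big_mkcond [LHS]big_mkcond.
by apply: eq_bigr => e _; rewrite unfold_in /=; do 2 case: (inc _ _).
Qed.

Lemma handshake : \sum_x deg x = 2 * #|E|.
Proof.
under eq_bigr do rewrite degE.
rewrite exchange_big /=; under eq_bigr do rewrite sum_incident.
by rewrite sum_nat_const mulnC.
Qed.

(** Each edge at [x] has exactly one other endpoint, so exactly one neighbour counts it. *)
Lemma sum_mult_nbhd (x : V) : \sum_(y in nbhd x) mult x y = deg x.
Proof.
have -> : \sum_(y in nbhd x) mult x y = \sum_(y | y != x) mult x y.
  rewrite [LHS]big_mkcond [RHS]big_mkcond; apply: eq_bigr => y _.
  by rewrite inE; case: (y != x) => //=; case: (mult x y).
under eq_bigr do rewrite multE.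
rewrite exchange_big degE [RHS]big_mkcond [LHS]big_mkcond; apply: eq_bigr => e _.
case: ifP => //= ex; have := sum_incident e.
by rewrite (bigD1 x) //= ex add1n => -[->].
Qed.

(** An edge [e] joining [x] and [y] has no further endpoint, so every edge meets [x] or [y] or is a
    non-neighbour of [e]. *)
Lemma mult_bound (x y : V) (n : nat) :
  (forall e, #|non_neighbours src dst e| <= n) -> y \in nbhd x ->
  #|E| + mult x y <= deg x + deg y + n.
Proof.
move=> hn; rewrite inE => /andP[yx /card_gt0P[e]]; rewrite inE => /andP[ex ey].
rewrite /Defs.deg -cardsUI addnAC leq_add //; last first.
  by rewrite subset_leq_card //; apply/subsetP=> f; rewrite !inE.
rewrite (leq_trans _ (leq_add (leqnn _) (hn e))) //.
apply: leq_trans (leq_card_setU _ _); rewrite -cardsT.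
apply/subset_leq_card/subsetP => f _; rewrite !inE.
have -> : share_endpoint src dst e f = inc f x || inc f y.
  move: ex ey yx; rewrite /share_endpoint /incident.
  case/orP=> /eqP<-; case/orP=> /eqP<-; rewrite ?eqxx // => _.
  by rewrite orbC.
have [->|] := eqVneq f e; first by rewrite ex.
by case: (inc f x); case: (inc f y).
Qed.

End Counting.

Arguments mult {V E}.
Arguments nbhd {V E}.

Lemma min_degree_contradiction (D m d k r S : nat) :
  d <= D -> 0 < k -> d * k <= S -> S <= k * D ->
  k * m + d <= S + k * (d + D) ->
  d + S + r * d <= 2 * m -> 2 * m <= (1 + k + r) * D ->
  5 * D < 2 * m -> False.
Proof.
move=> dD k0 dS SD hk hs hn hm.
have kr : 6 <= 1 + k + r by nia.
have hd : D < 2 * d by nia.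
(* For k <= 2, inserting S <= kD in [hk] suffices. For k >= 3, [hk] and [hs] give (k-2)m <= (k-2-r)d
   + kD; conclude by r >= 2 and D < 2d if k = 3, r >= 1 if k = 4, 6d <= 2m if k = 5, and d <= D if k
   >= 6. *)
case: k k0 dS SD hk hs hn kr => [//|[|[|[|[|[|k]]]]]] _ dS SD hk hs hn kr; nia.
Qed.

(* |E(H)| <= 5/2 D is stated as 2 |E| <= 5 D;
   "at most D - 2" (integer D - 2) is stated as  n + 2 <= D. *)
Theorem theorem4 (D : nat) (V E : finType) (src dst : E -> V)
  (hD : 0 < D)
  (hloopless : forall e : E, src e != dst e)
  (hdeg : maxdeg_le src dst D)
  (hshare : forall e : E, #|non_neighbours src dst e| + 2 <= D) :
  2 * #|E| <= 5 * D.
Proof.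
rewrite leqNgt; apply/negP => hm.
have nonneigh e : #|non_neighbours src dst e| <= D by have := hshare e; lia.
have /card_gt0P[e0 _] : 0 < #|E| by lia.
pose supp x := 0 < deg src dst x.
have supp_mult x y : 0 < mult src dst x y -> supp x && supp y.
  case/card_gt0P=> e; rewrite inE => /andP[ex ey].
  by rewrite /supp; apply/andP; split; apply/card_gt0P; exists e; rewrite inE.
have s0 : supp (src e0).
  by apply/card_gt0P; exists e0; rewrite inE /incident eqxx.
case: (arg_minnP (deg src dst) s0) => v sv vmin.
set N := nbhd src dst v; set S := \sum_(u in N) deg src dst u.
set R := [set x | supp x && (x != v) && (x \notin N)].
have N_supp u : u \in N -> supp u by rewrite inE => /andP[_ /supp_mult/andP[]].
(* The support splits into [v], its neighbours [N] and the rest [R]. *)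
have sumE (F : V -> nat) : (forall x, ~~ supp x -> F x = 0) ->
    \sum_x F x = F v + \sum_(x in N) F x + \sum_(x in R) F x.
  move=> F0; rewrite (bigD1 v) //= -addnA; congr (_ + _).
  rewrite (bigID (mem N)) /=; congr (_ + _).
    by apply: eq_bigl => x; rewrite inE; case: (x != v).
  rewrite [LHS]big_mkcond [RHS]big_mkcond; apply: eq_bigr => x _.
  rewrite [x \in R]inE -andbA; case sx: (supp x) => //=.
  by case: ifP => // _; rewrite F0 ?sx.
have hsum : deg src dst v + S + \sum_(x in R) deg src dst x = 2 * #|E|.
  rewrite -(handshake _ _ _ _ hloopless) sumE // => x.
  by rewrite -leqNgt leqn0 => /eqP.
have hS : S <= #|N| * D by rewrite -sum_nat_const; apply: leq_sum.
have hS' : deg src dst v * #|N| <= S.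
  by rewrite mulnC -sum_nat_const; apply: leq_sum => u /N_supp /vmin.
have hR : \sum_(x in R) deg src dst x <= #|R| * D.
  by rewrite -sum_nat_const; apply: leq_sum.
have hR' : #|R| * deg src dst v <= \sum_(x in R) deg src dst x.
  rewrite -sum_nat_const; apply: leq_sum => u.
  by rewrite inE => /andP[/andP[/vmin]].
have hN : \sum_(u in N) mult src dst v u = deg src dst v by exact: sum_mult_nbhd.
have N0 : 0 < #|N|.
  rewrite lt0n; apply/eqP => /cards0_eq N0.
  by move: hN sv; rewrite N0 big_set0 /supp => <-.
(* Sum [mult_bound] over [N]; by [hN] the multiplicities add up to the degree of [v]. *)
have hk : #|N| * #|E| + deg src dst v <= S + #|N| * (deg src dst v + D).
  rewrite -{1}hN -!sum_nat_const -!big_split /=; apply: leq_sum => u uN.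
  by rewrite addnA [deg _ _ u + _]addnC; apply: mult_bound.
have hv := hdeg v.
apply: (@min_degree_contradiction D #|E| (deg src dst v) #|N| #|R| S) => //; lia.
Qed.
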